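(* For any $K>1$, every $\varepsilon>0$ and each ordinal $\alpha<\omega_1$, there exists an ordinal $\beta<\omega_1$ such that if $(x_n)$ is a normalized basic sequence (in a Banach space) having an $\ell_1$-$\mathcal S_\beta$-spreading model with constant $K$, then there exists a normalized block basis $(y_n)$ of $(x_n)$ having an $\ell_1$-$\mathcal S_\alpha$-spreading model with constant $1+\varepsilon$.
   Context: Schreier sets. For finite sets $E,F\subseteq\mathbf N$, $E<F$ means $\max E<\min F$; $n\leq F$ means $n\leq\min F$ and $n<F$ means $n<\min F$. For collections $\mathcal M,\mathcal N$ of finite sets of positive integers, $\mathcal M[\mathcal N]$ is the collection of all $\bigcup_1^kF_i$ with $k\ge1$, $F_i\in\mathcal N$, for which there is $\{m_1,\dots,m_k\}\in\mathcal M$ with $m_1\leq F_1<m_2\leq F_2<\dots<m_k\leq F_k$. Put $\mathcal S_0=\{\{n\}:n\geq1\}\cup\{\emptyset\}$, $\mathcal S_1=\{F\subset\mathbf N:|F|\leq\min F\}$ (including $\emptyset$) $=\mathcal S_1[\mathcal S_0]$, $\mathcal S_{\alpha+1}=\mathcal S_1[\mathcal S_\alpha]$, and for $\alpha$ a countable limit ordinal choose (and fix) an increasing sequence of ordinals $(\alpha_n)$ with $\alpha=\sup_n\alpha_n$ and let $\mathcal S_\alpha=\bigcup_{n\ge1}\{F\in\mathcal S_{\alpha_n}:n\leq F\}$. Spreading models. A sequence $(x_n)_{n=1}^\infty$ of norm-one vectors has an $\ell_1$-$\mathcal S_\alpha$-spreading model with constant $K$ if for every $F\in\mathcal S_\alpha$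 there are constants $c,C>0$ with $c^{-1}C\leq K$ and $c\sum_{i\in F}|a_i|\leq\|\sum_{i\in F}a_ix_i\|\leq C\sum_{i\in F}|a_i|$ for all real $(a_i)_{i\in F}$. Banach spaces are real. *)

(* Defs.v *)
From HB Require Import structures.
From mathcomp Require Import all_boot all_order all_algebra finmap.
From mathcomp Require Import all_classical all_reals all_analysis.
From mathcomp Require wochoice.
Set Implicit Arguments.
Unset Strict Implicit.
Unset Printing Implicit Defensive.
Import Order.TTheory GRing.Theory Num.Theory.
Import numFieldNormedType.Exports.
Local Open Scope classical_set_scope.
Local Open Scope ring_scope.

(* An ordered type has order type omega_1 iff it is well ordered, all its proper
   initial segments are countable and it is not; its elements then play the role
   of the ordinals < omega_1. Such a type exists, see [omega1_exists]. *)
Definition is_omega1 (d : Order.disp_t) (W : orderType d) : Prop :=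
  [/\ wochoice.well_order (<=%O : rel W),
      forall a : W, countable [set b : W | (b < a)%O]
    & ~ countable [set: W]].

Lemma well_order_total_order (T : eqType) (r : rel T) :
  wochoice.well_order r -> wochoice.total_order r.
Proof.
move=> wo; have /wochoice.withinW woc := wo.
have rtot x y : r x y || r y x by exact: (wochoice.wo_chainW (woc xpredT)).
have ranti : antisymmetric r.
  by move=> x y; exact: (wochoice.wo_chain_antisymmetric (woc xpredT)).
split=> //; split=> //; split=> [x|y x z xy yz].
  by have := rtot x x; rewrite orbb.
have [|t [[tA tmin] _]] := wo (mem [:: x; y; z]).
  by exists x; exact: mem_head.
have tx : r t x by apply: tmin; rewrite !inE eqxx.
have ty : r t y by apply: tmin; rewrite !inE eqxx orbT.
have tz : r t z by apply: tmin; rewrite !inE eqxx !orbT.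
move: tA; rewrite !inE => /or3P[/eqP <-//|/eqP ety|/eqP etz].
  by rewrite (_ : x = y) //; apply: ranti; rewrite xy -ety tx.
by rewrite (_ : y = z) // in xy *; apply: ranti; rewrite yz -etz ty.
Qed.

Lemma set_nat_uncountable : ~ countable [set: set nat].
Proof.
move=> /countable_injP[f /in2TT finj].
pose D := [set n | exists2 A, n = f A & ~ A n].
have [DfD|nDfD] := pselect (D (f D)); last by apply: (nDfD); exists D.
by case: (DfD) => A /finj <-.
Qed.

Lemma omega1_exists :
  exists (d : Order.disp_t) (W : orderType d), is_omega1 W.
Proof.
have [r wor] := wochoice.well_ordering_principle (set nat : eqType).
have [[[rrefl rtrans] ranti] rtot] := well_order_total_order wor.
pose P x := `[< countable [set y | r y x && (y != x)] >].
pose S : choiceType := {x : set nat | P x}.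
pose le (u v : S) := r (val u) (val v).
pose lt (u v : S) := (v != u) && le u v.
have le_anti : antisymmetric le by move=> u v /ranti /val_inj.
have le_trans : transitive le by move=> v u w; exact: rtrans.
have le_total : total le by move=> u v; exact: rtot.
pose d := Order.Disp tt tt.
pose oM := Order.isOrder.Build d S (le := le) (lt := lt)
  (fun u v => erefl) (fun u v => erefl) (fun u v => erefl)
  le_anti le_trans le_total.
pose W : orderType d := HB.pack S oM.
have leE (u v : W) : (u <= v)%O = r (val (u : S)) (val (v : S)) by [].
exists d, W; split.
- apply: wochoice.antisymmetric_well_order => [|A [u uA]]; first exact: le_anti.
  have [|z [[/asboolP[v vA vz] zmin] _]] :=
    wor (fun x => `[< exists2 v : S, v \in A & val v = x >]).
    by exists (val u); apply/asboolP; exists u.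
  exists v; split=> // w wA; rewrite leE vz.
  by apply: zmin; apply/asboolP; exists w.
- move=> a; have /asboolP/countable_injP[f finj] := valP (a : S).
  apply/countable_injP; exists (fun b : W => f (val (b : S))) => u v.
  rewrite !inE /= !lt_def !leE => /andP[ua ra] /andP[va rv] fuv.
  apply/val_inj/finj => //; rewrite inE /= ?ra ?rv /=.
    by apply: contra ua => /eqP/val_inj ->.
  by apply: contra va => /eqP/val_inj ->.
- move=> cW; have cP : countable [set x | P x].
    rewrite (_ : [set x | P x] = val @` [set: S]).
      exact: sub_countable (card_image_le _ _) cW.
    apply/seteqP; split=> [x Px|_ [v _ <-]]; last exact: valP v.
    by exists (exist _ x Px).
  have [allP|] := pselect (forall x, P x).
    apply: set_nat_uncountable; rewrite (_ : [set: _] = [set x | P x]) //.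
    by apply/seteqP; split=> x _ /=; [exact: allP|].
  move=> /existsNP[x nPx].
  have [|z [[/negP nPz zmin] _]] := wor (fun x => ~~ P x).
    by exists x; apply/negP.
  apply: nPz; apply/asboolP; apply: sub_countable cP; apply: subset_card_le.
  move=> y /= /andP[yz ynz]; apply: contraT => /zmin zy.
  by rewrite (ranti y z) ?eqxx ?yz // in ynz.
Qed.

Section Ordinals.
Context {d : Order.disp_t} {W : orderType d}.
Implicit Types a b c : W.

Definition is_zero a := forall b, (a <= b)%O.
Definition is_succ a b := (a < b)%O /\ forall c, (a < c)%O -> (b <= c)%O.
Definition is_limit b := ~ is_zero b /\ forall a, ~ is_succ a b.

(* Sequences indexed by n >= 1 are stored as functions on nat starting at 0:
   the value at n stands for the term of index n + 1. *)
Definition fundamental_system (lam : W -> nat -> W) : Prop :=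
  forall a, is_limit a ->
    {homo lam a : m n / (m < n)%N >-> (m < n)%O} /\
    supremums (range (lam a)) a.

Lemma limit_dense a b : is_limit b -> (a < b)%O -> exists c, (a < c < b)%O.
Proof.
move=> [_ /(_ a) nab] ab; apply: contrapT => /forallNP nc; apply: nab.
split=> // c ac.
by rewrite leNgt; apply/negP => cb; apply: (nc c); rewrite ac.
Qed.

Lemma fundamental_system_exists :
  is_omega1 W -> exists lam : W -> nat -> W, fundamental_system lam.
Proof.
move=> [_ cW _].
suff /choice[lam lamP] : forall a, exists l : nat -> W, is_limit a ->
    {homo l : m n / (m < n)%N >-> (m < n)%O} /\ supremums (range l) a.
  by exists lam => a /lamP.
move=> a; have [la|] := pselect (is_limit a); last by exists (fun=> a).
have /countable_injP[f finj] := cW a.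
have /existsNP[b0 /negP] := la.1; rewrite -ltNge => b0a.
have step (p : nat * W) : exists q : W, (p.2 < a)%O ->
    [/\ (p.2 < q)%O, (q < a)%O & forall b, (b < a)%O -> f b = p.1 -> (b < q)%O].
  case: p => n c /=; have [ca|] := boolP (c < a)%O; last by exists c.
  have [[b [ba fb]]|nb] := pselect (exists b, (b < a)%O /\ f b = n).
    have bca : (Order.max b c < a)%O by rewrite gt_max ba.
    have [q /andP[]] := limit_dense la bca; rewrite gt_max => /andP[bq cq] qa.
    exists q => _; split=> // b' b'a fb'.
    by rewrite (finj b' b) ?inE //= fb fb'.
  have [q /andP[cq qa]] := limit_dense la ca; exists q => _; split=> // b ba fb.
  by case: nb; exists b.
have [nxt nxtP] := choice step.
pose l := fix l n := if n is m.+1 then nxt (m, l m) else b0.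
have la_lt n : (l n < a)%O by elim: n => //= n /(nxtP (n, l n)) [].
exists l => _; split.
  apply: homo_ltn; first by move=> y x z; exact: lt_trans.
  by move=> n; have [] := nxtP (n, l n) (la_lt n).
split=> [_ [n _ <-]|u ub]; first exact: ltW.
rewrite leNgt; apply/negP => ua.
have [_ _ /(_ u ua erefl)] := nxtP (f u, l (f u)) (la_lt (f u)).
by rewrite ltNge => /negP; apply; apply: ub; exists (f u).+1.
Qed.

End Ordinals.

Definition schreier0 : set {fset nat} :=
  [set F | F = fset0 \/ exists2 n, (0 < n)%N & F = [fset n]%fset].

(* |F| <= min F, with min of the empty set equal to infinity. *)
Definition schreier1 : set {fset nat} :=
  [set F | forall n, n \in F -> (#|` F| <= n)%N].

(* M[N]. The sets G i may be empty, so m_1 <= F_1 < m_2 <= ... <= F_k is read as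
   m_1 < ... < m_k together with m_i <= F_i < m_(i+1). *)
Definition fam_comp (M N : set {fset nat}) : set {fset nat} :=
  [set F | exists k (m : nat -> nat) (G : nat -> {fset nat}),
    [/\ (0 < k)%N /\ M [fset m i | i in iota 0 k]%fset,
        forall i, (i.+1 < k)%N -> (m i < m i.+1)%N,
        forall i, (i < k)%N -> N (G i) /\ forall n, n \in G i -> (m i <= n)%N,
        forall i, (i.+1 < k)%N -> forall n, n \in G i -> (n < m i.+1)%N
      & F = (\bigcup_(i <- iota 0 k) G i)%fset]].

(* The families S_a for a fixed choice [lam] of sequences increasing to the
   limit ordinals; the defining equations are [schreier_zeroE], [schreier_succE]
   and [schreier_limitE]. *)
Inductive schreier (d : Order.disp_t) (W : orderType d) (lam : W -> nat -> W)
    (a : W) (F : {fset nat}) : Prop :=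
| SchreierZero of is_zero a & schreier0 F
| SchreierSucc b of is_succ b a & fam_comp schreier1 (schreier lam b) F
| SchreierLimit n of is_limit a & schreier lam (lam a n) F &
    (forall i, i \in F -> (n.+1 <= i)%N).

Section SchreierTheory.
Context {d : Order.disp_t} {W : orderType d} (lam : W -> nat -> W).
Implicit Types a b : W.

Lemma succ_not_zero a b : is_succ a b -> ~ is_zero b.
Proof. by move=> [ab _] /(_ a); rewrite leNgt ab. Qed.

Lemma succ_inj a a' b : is_succ a b -> is_succ a' b -> a = a'.
Proof.
move=> [ab ha] [ab' ha']; apply/eqP; rewrite eq_le; apply/andP; split.
  by rewrite leNgt; apply/negP => /ha'; rewrite leNgt ab.
by rewrite leNgt; apply/negP => /ha; rewrite leNgt ab'.
Qed.

Lemma schreier_zeroE a : is_zero a -> schreier lam a = schreier0.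
Proof.
move=> a0; apply/seteqP; split => F; last by move=> F0; exact: SchreierZero.
by case=> // [b ba _|n [/(_ a0)//]]; case: (succ_not_zero ba a0).
Qed.

Lemma schreier_succE a b : is_succ a b ->
  schreier lam b = fam_comp schreier1 (schreier lam a).
Proof.
move=> ab; apply/seteqP; split => F; last exact: SchreierSucc.
case=> [b0|c cb|n [_ /(_ a)//]]; first by case: (succ_not_zero ab b0).
by rewrite (succ_inj cb ab).
Qed.

Lemma schreier_limitE a : is_limit a -> schreier lam a =
  [set F | exists n, schreier lam (lam a n) F /\
                     forall i, i \in F -> (n.+1 <= i)%N].
Proof.
move=> la; apply/seteqP; split => F.
  case=> [a0|b ba|n _ Fn ni]; [by case: la|by case: la => _ /(_ b)|by exists n].
by move=> [n [Fn ni]]; exact: (SchreierLimit la Fn).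
Qed.

End SchreierTheory.

Section Sequences.
Context {R : realType} {E : completeNormedModType R}.
Implicit Types x y : nat -> E.

Definition normalized x := forall n, `|x n| = 1.

Definition closed_span x : set E :=
  closure [set z | exists n (a : nat -> R), z = \sum_(i < n) a i *: x i].

(* x is a Schauder basis of its closed linear span. *)
Definition basic_sequence x : Prop :=
  forall z, closed_span x z ->
    exists! a : nat -> R, series (fun n => a n *: x n) @ \oo --> z.

Definition block_basis x y : Prop :=
  exists (p : nat -> nat) (a : nat -> R),
    {homo p : m n / (m < n)%N} /\
    forall n, y n = \sum_(p n <= i < p n.+1) a i *: x i /\ y n != 0.

(* The members of A are sets of positive integers and the vector of index i >= 1
   is x i.-1, because x is stored from 0 on. *)
Definition l1_spreading_model (A : set {fset nat}) x (K : R) : Prop :=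
  forall F, A F -> exists c C : R,
    [/\ 0 < c, 0 < C, c^-1 * C <= K
      & forall a : nat -> R,
          c * (\sum_(i <- F) `|a i|) <= `|\sum_(i <- F) a i *: x i.-1|
          /\ `|\sum_(i <- F) a i *: x i.-1| <= C * (\sum_(i <- F) `|a i|)].

End Sequences.

(* Main.v *)
Require Import Defs.
From HB Require Import structures.
From mathcomp Require Import all_boot all_order all_algebra finmap.
From mathcomp Require Import all_classical all_reals all_analysis.
Set Implicit Arguments.
Unset Strict Implicit.
Unset Printing Implicit Defensive.
Import Order.TTheory GRing.Theory Num.Theory.
Import numFieldNormedType.Exports.
Local Open Scope classical_set_scope.
Local Open Scope ring_scope.

(** The constant is improved by James' square root argument, which trades it
    against the size of the Schreier family.

    For a normalized sequence, having an l1-A-spreading model amounts to a lower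
    estimate t * sum |a_i| <= |sum a_i x_i| for F in A, as the triangle
    inequality supplies the upper one with C = 1; the constant of the spreading
    model is then 1 / t ([l1_spreading_model_lower],
    [l1_lower_spreading_model]).

    Suppose that x has such an estimate with constant t ^+ 2 on a family B that
    is much larger than S_a. Either some tail of x already satisfies the
    estimate with constant t on S_a, and then so does the shifted sequence since
    S_a is spreading; or arbitrarily far out there are vectors
    v = sum_(j in F) c_j x_j, with F in S_a, for which |v| < t * sum |c_j|. In
    the second case, a sequence of normalized vectors of this kind, successively
    supported, is a block sequence y. For G in S_a, a combination of the y_i
    with i in G is a combination of the x_j with j in the union of the
    corresponding sets F_i, so that the constant t ^+ 2 of x on B becomes at
    least t ^+ 2 / t = t for y ([james_blocks], [james_step]).

    This requires B to contain the unions of the F_i. Such a B = S_b is found in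
    [schreier_comp] by transfinite induction on the index of the outer family,
    for sets F_i that go to infinity fast enough: at limits, b is chosen above
    countably many ordinals, and for c < b the members of S_c are known to be in
    S_b only when they lie beyond some integer ([schreier_tail]).

    Iterating k times takes the constant from t ^+ (2 ^ k) to t
    ([james_iter]), and t = 1 / (1 + eps) satisfies t ^+ (2 ^ k) <= 1 / K for k
    large. *)

(** * Blocks of integers *)

Lemma homo_ltn_leq (p : nat -> nat) :
  {homo p : m n / (m < n)%N} -> {homo p : m n / (m <= n)%N}.
Proof.
move=> ph m n; rewrite leq_eqVlt => /orP[/eqP->//|/ph/ltnW//].
Qed.

Lemma homo_ltn_ge_id (p : nat -> nat) n :
  {homo p : m n / (m < n)%N} -> (n <= p n)%N.
Proof.
by move=> ph; elim: n => // n /leq_ltn_trans; apply; apply: ph.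
Qed.

(** Consecutive blocks are disjoint, so that choices made block by block combine
    into one sequence. *)
Lemma glue_blocks (T : Type) (p : nat -> nat) (A : nat -> nat -> T) :
  {homo p : m n / (m < n)%N} ->
  exists c : nat -> T, forall i j, (p i <= j < p i.+1)%N -> c j = A i j.
Proof.
move=> ph; have ple := homo_ltn_leq ph.
suff /choice[c cP] : forall j, exists v, forall i, (p i <= j < p i.+1)%N -> v = A i j.
  by exists c => i j /cP.
move=> j; have [[i ij]|nij] := pselect (exists i, (p i <= j < p i.+1)%N); last first.
  by exists (A 0%N j) => i ij; case: nij; exists i.
exists (A i j) => k kj; congr (A _ j).
have lt m n : (p m <= j < p m.+1)%N -> (p n <= j < p n.+1)%N -> (m <= n)%N.
  move=> /andP[mj _] /andP[_ jn]; rewrite leqNgt; apply/negP => /ple nm.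
  by have := leq_trans (leq_trans jn nm) mj; rewrite ltnn.
by apply/eqP; rewrite eqn_leq (lt k i) ?(lt i k).
Qed.

(** [F N] stands for a set chosen beyond [N]; successive blocks are obtained by
    taking [N] past the end of the previous block, and past the next value of
    the growth function [L]. *)
Lemma sparse_blocks (F : nat -> {fset nat}) (L : nat -> nat) :
  (forall N i, i \in F N -> (N <= i)%N) ->
  exists p : nat -> nat, [/\ {homo p : m n / (m < n)%N},
    forall i, (0 < p i)%N, forall i, (L i <= p i)%N
  & forall i j, j \in F (p i) -> (p i <= j < p i.+1)%N].
Proof.
move=> NF.
(* The sum of the elements of F (p k) is used as an upper bound for them. *)
pose p := fix p i := if i is k.+1 then
  (p k + \sum_(j <- F (p k)) j + L i).+1 else (L 0).+1.
have pS i : p i.+1 = (p i + \sum_(j <- F (p i)) j + L i.+1).+1 by [].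
have plt i : (p i < p i.+1)%N by rewrite pS ltnS -addnA leq_addr.
exists p; split; first by apply: homo_ltn => // y x z; exact: ltn_trans.
- by case.
- by case=> [|i]; rewrite ?pS ltnW // ltnS leq_addl.
- move=> i j jF; rewrite NF //= ltnS.
  apply: leq_trans (leq_addr _ _); apply: leq_trans (leq_addl _ _).
  by rewrite (big_fsetD1 j) //= leq_addr.
Qed.

(** * Compositions along blocks *)

(** The analogue of the inclusion of the composition M[N] in B for blocks that
    are sparse, in the sense of the growth function [L]. The sets that are joined
    are indexed by a member of [M] instead of being separated by its elements, so
    that M can be applied to the indices of a block sequence. *)
Definition sparse_comp_sub (L : nat -> nat) (M N B : set {fset nat}) :=
  forall (p : nat -> nat) (F : nat -> {fset nat}) (G : {fset nat}),
  {homo p : m n / (m < n)%N} -> M G ->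
  (forall i, i \in G -> [/\ (L i <= p i)%N, N (F i)
     & forall j, j \in F i -> (p i <= j < p i.+1)%N]) ->
  B (\bigcup_(i <- G) F i)%fset.

(** The common step of the inductions at successor ordinals: if G is decomposed
    along m_1 < ... < m_k, then the union over G of the blocks F_i is decomposed
    along p(m_1) < ... < p(m_k), and the set of these integers is in S_1 because
    [p] is increasing. *)
Lemma fam_comp_blocks (M N : set {fset nat}) (p : nat -> nat)
    (F : nat -> {fset nat}) (G : {fset nat}) :
  {homo p : m n / (m < n)%N} ->
  (forall i, i \in G -> forall j, j \in F i -> (p i <= j < p i.+1)%N) ->
  fam_comp schreier1 M G ->
  (forall H, M H -> {subset H <= G} -> N (\bigcup_(i <- H) F i)%fset) ->
  fam_comp schreier1 N (\bigcup_(i <- G) F i)%fset.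
Proof.
move=> ph Fp [k [m [H [[k0 m1] mlt HM Hm GE]]]] MN.
have ple := homo_ltn_leq ph.
have HG j : (j < k)%N -> {subset H j <= G}.
  move=> jk i iH; rewrite GE; apply/bigfcupP; exists j => //.
  by rewrite mem_iota add0n jk.
exists k, (p \o m), (fun j => \bigcup_(i <- H j) F i)%fset; split.
- split=> // n /imfsetP[/= i ik ->].
  have -> : [fset (p \o m) i | i in iota 0 k]%fset =
            [fset p n | n in [fset m i | i in iota 0 k]]%fset.
    apply/fsetP => x; apply/imfsetP/imfsetP => /= [[j jk ->]|].
      by exists (m j) => //; apply: in_imfset.
    by move=> [_ /imfsetP[/= j jk ->] ->]; exists j.
  apply: leq_trans (leq_imfset_card _ _ _) _.
  apply: leq_trans (homo_ltn_ge_id (m i) ph).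
  by apply: m1; apply: in_imfset.
- by move=> i ik; apply/ph/mlt.
- move=> j jk; have [HMj Hj] := HM j jk; split; first by apply: MN (HG _ jk).
  move=> n /bigfcupP[i /andP[iH _] /Fp]; move/(_ (HG _ jk _ iH)) => /andP[pn _].
  exact: leq_trans (ple _ _ (Hj _ iH)) pn.
- move=> j jk n /bigfcupP[i /andP[iH _] /Fp].
  move/(_ (HG _ (ltnW jk) _ iH)) => /andP[_ np].
  exact: leq_trans np (ple _ _ (Hm _ jk _ iH)).
- apply/fsetP => x; rewrite GE; apply/bigfcupP/bigfcupP => /=.
    move=> [i /andP[/bigfcupP[j jk iH] _] xF]; exists j => //.
    by apply/bigfcupP; exists i; rewrite ?iH.
  move=> [j jk /bigfcupP[i /andP[iH _] xF]]; exists i => //; rewrite andbT.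
  by apply/bigfcupP; exists j.
Qed.

(** * Countable ordinals *)

Section Omega1.
Context {d : Order.disp_t} {W : orderType d}.
Hypothesis W_omega1 : is_omega1 W.
Implicit Types a b c : W.

Lemma omega1_min (P : W -> Prop) a : P a ->
  exists2 m, P m & forall b, P b -> (m <= b)%O.
Proof.
move=> Pa; have [wo _ _] := W_omega1.
have [|m [[/asboolP Pm mmin] _]] := wo (fun b => `[< P b >]).
  by exists a; apply/asboolP.
by exists m => // b Pb; apply: mmin; apply/asboolP.
Qed.

Lemma omega1_ind (P : W -> Prop) :
  (forall a, (forall b, (b < a)%O -> P b) -> P a) -> forall a, P a.
Proof.
move=> IH a; apply: contrapT => nPa.
have [m nPm mmin] := omega1_min (P := fun b => ~ P b) nPa.
apply: nPm; apply: IH => b bm; apply: contrapT => /mmin.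
by rewrite leNgt bm.
Qed.

(** Otherwise a type of order type omega_1 would be a countable union of
    countable initial segments. *)
Lemma omega1_cofinality (u : nat -> W) : exists b, forall n, (u n < b)%O.
Proof.
apply: contrapT => /forallNP nub; have [_ cW] := W_omega1; apply.
rewrite (_ : setT = \bigcup_n ([set b | (b < u n)%O] `|` [set u n])).
  apply: bigcup_countable => // n _.
  have -> : [set b | (b < u n)%O] `|` [set u n] =
    \bigcup_i (if i is 0%N then [set b | (b < u n)%O] else [set u n]).
    apply/seteqP; split=> [x [xl|xu]|x [[|i] _ /= xi]].
    - by exists 0%N.
    - by exists 1%N.
    - by left.
    - by right.
  by apply: bigcup_countable => // -[|i] _; [exact: cW|exact: countable1].
apply/seteqP; split=> // x _.
have /existsNP[n /negP] := nub x; rewrite -leNgt le_eqVlt => /orP[/eqP->|xn].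
  by exists n => //; right.
by exists n => //; left.
Qed.

Lemma omega1_succ a : exists b, is_succ a b.
Proof.
have [b /(_ 0%N) ab] := omega1_cofinality (fun=> a).
have [c ac cmin] := omega1_min (P := fun c => (a < c)%O) ab.
by exists c; split.
Qed.

Lemma omega1_zero_succ_limit a :
  [\/ is_zero a, exists b, is_succ b a | is_limit a].
Proof.
have [a0|na0] := pselect (is_zero a); first exact: Or31.
have [sa|nsa] := pselect (exists b, is_succ b a); first exact: Or32.
by apply: Or33; split=> // b ba; apply: nsa; exists b.
Qed.

Context {lam : W -> nat -> W} (lam_fund : fundamental_system lam).

Lemma fundamental_lt a n : is_limit a -> (lam a n < a)%O.
Proof.
move=> /lam_fund[lam_homo [lam_ub _]].
by apply: lt_le_trans (lam_homo _ _ (ltnSn n)) (lam_ub _ _); exists n.+1.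
Qed.

Lemma fundamental_cofinal a b : is_limit a -> (b < a)%O ->
  exists n, (b < lam a n)%O.
Proof.
move=> /lam_fund[_ [_ lam_min]] ba; apply: contrapT => /forallNP nb.
suff /lam_min : ubound (range (lam a)) b by rewrite leNgt ba.
by move=> _ [n _ <-]; rewrite leNgt; apply/negP/nb.
Qed.

(** * Schreier families *)

Lemma schreier0_sub a : schreier0 `<=` schreier lam a.
Proof.
move=> F F0; elim/omega1_ind: a => a IH.
have [n n0 nF] : exists2 n, (0 < n)%N & forall i, i \in F -> (n <= i)%N.
  case: F0 => [->|[n n0 ->]]; first by exists 1%N.
  by exists n => // i; rewrite inE => /eqP->.
have [a0|[b ba]|la] := omega1_zero_succ_limit a.
- exact: SchreierZero.
- apply: (SchreierSucc ba); exists 1%N, (fun=> n), (fun=> F).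
  split=> //; last by rewrite big_seq1.
    split=> // i /imfsetP[/= _ _ ->].
    by rewrite (leq_trans (leq_imfset_card _ _ _)).
  by move=> _ _; split=> //; apply: IH; case: ba.
- apply: (SchreierLimit (n := 0) la); first by apply/IH/fundamental_lt.
  by move=> i /nF; apply: leq_trans.
Qed.

Lemma schreier_gt0 a F : schreier lam a F -> forall i, i \in F -> (0 < i)%N.
Proof.
elim/omega1_ind: a F => a IH F; case.
- move=> _ [-> //|[n n0 ->]] i; rewrite inE => /eqP-> //.
- move=> b ba [k [m [G [_ _ Gb _ ->]]]] i /bigfcupP[j /andP[]].
  rewrite mem_iota add0n /= => jk _ /(IH b ba.1 _ (Gb j jk).1); exact.
- by move=> n _ _ nF i /nF; apply: leq_trans.
Qed.

(** The bound [M] accounts for the condition n <= F at limits, which may exclude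
    sets that start too early; at successors, a set beyond a positive integer is
    the union of one piece, and the singleton of that integer is in S_1. *)
Lemma schreier_tail a b : (a < b)%O -> exists M, forall F,
  schreier lam a F -> (forall i, i \in F -> (M <= i)%N) -> schreier lam b F.
Proof.
elim/omega1_ind: b a => b IH a ab.
have [b0|[c cb]|lb] := omega1_zero_succ_limit b.
- by have := b0 a; rewrite leNgt ab.
- have [M HM] : exists M, forall F, schreier lam a F ->
      (forall i, i \in F -> (M <= i)%N) -> schreier lam c F.
    have := ltP a c; case=> [ac|]; first by apply: IH => //; case: cb.
    rewrite le_eqVlt => /orP[/eqP<-|ca]; first by exists 0%N.
    by move: cb => [_ /(_ _ ca)]; rewrite leNgt ab.
  exists M.+1 => F aF MF; apply: (SchreierSucc cb).
  exists 1%N, (fun=> M.+1), (fun=> F); split=> //; last by rewrite big_seq1.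
    split=> // i /imfsetP[/= _ _ ->].
    by rewrite (leq_trans (leq_imfset_card _ _ _)).
  by move=> _ _; split=> //; apply: HM => // i /MF/ltnW.
- have [n an] := fundamental_cofinal lb ab.
  have [M HM] := IH _ (fundamental_lt n lb) _ an.
  exists (maxn M n.+1) => F aF MF; apply: (SchreierLimit (n := n) lb).
    by apply: HM => // i /MF; rewrite geq_max => /andP[].
  by move=> i /MF; rewrite geq_max => /andP[].
Qed.

(** S_a is spreading; only spreads along increasing maps of all integers are
    considered, as they keep the inductive hypothesis uniform. *)
Lemma schreier_spread a (p : nat -> nat) G : {homo p : m n / (m < n)%N} ->
  schreier lam a G -> schreier lam a (\bigcup_(i <- G) [fset p i])%fset.
Proof.
move=> ph; elim/omega1_ind: a G => a IH G; case.
- move=> a0 [->|[n n0 ->]]; apply: SchreierZero => //.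
    by left; rewrite big_seq_fset0.
  right; exists (p n); last by rewrite big_seq_fset1.
  exact: leq_trans (homo_ltn_ge_id n ph).
- move=> b ba Gb; apply: (SchreierSucc ba).
  apply: (fam_comp_blocks ph _ Gb).
    by move=> i _ j; rewrite inE => /eqP->; rewrite leqnn ph.
  by move=> H Hb _; apply: IH => //; case: ba.
- move=> n la Gn nG; apply: (SchreierLimit la (IH _ (fundamental_lt n la) _ Gn)).
  move=> j /bigfcupP[i /andP[/nG ni _]]; rewrite inE => /eqP->.
  exact: leq_trans ni (homo_ltn_ge_id i ph).
Qed.

(** The composition S_a[S_c] lies in some S_b, up to sparseness. At a limit [a],
    the ordinals obtained for the terms of the sequence of [a] are bounded by one
    ordinal, and [L i] accommodates the requirements of the terms of index at
    most [i]: a set of S_a that comes from the n-th term lies beyond n, so that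
    the growth imposed by this term is met on all of it. *)
Lemma schreier_comp a c : exists b L,
  sparse_comp_sub L (schreier lam a) (schreier lam c) (schreier lam b).
Proof.
elim/omega1_ind: a => a IH.
have [a0|[a' sa]|la] := omega1_zero_succ_limit a.
- exists c, (fun=> 0%N) => p F G ph; rewrite schreier_zeroE // => -[->|[n n0 ->]] FG.
    by rewrite big_seq_fset0; apply: schreier0_sub; left.
  by rewrite big_seq_fset1; have [] := FG n; rewrite ?inE.
- have [b [L bL]] := IH _ sa.1; have [b' sb] := omega1_succ b.
  exists b', L => p F G ph; rewrite (schreier_succE _ sa) => Ga FG.
  apply: (SchreierSucc sb); apply: (fam_comp_blocks ph _ Ga).
    by move=> i /FG[].
  by move=> H Ha HG; apply: (bL p) => // i /HG/FG.
- have /choice[b bP] : forall n, exists b L,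
      sparse_comp_sub L (schreier lam (lam a n)) (schreier lam c)
        (schreier lam b).
    by move=> n; apply/IH/fundamental_lt.
  have /choice[L LP] := bP.
  have [s sP] := omega1_cofinality b.
  have /choice[M MP] := fun n => schreier_tail (sP n).
  exists s, (fun i => \sum_(n < i) (L n i + M n))%N => p F G ph.
  rewrite (schreier_limitE _ la) => -[n [Gn nG]] FG.
  have LMp i : i \in G -> (L n i + M n <= p i)%N.
    move=> iG; have [Lp _ _] := FG _ iG; apply: leq_trans Lp.
    by rewrite (bigD1 (Ordinal (nG _ iG))) //= leq_addr.
  apply: (MP n).
    apply: (LP n p) => // i iG; have [_ Fi Fp] := FG i iG; split=> //.
    exact: leq_trans (leq_addr _ _) (LMp _ iG).
  move=> j /bigfcupP[i /andP[iG _] jF]; have [_ _ Fp] := FG i iG.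
  have /andP[pj _] := Fp _ jF.
  by apply: leq_trans pj; apply: leq_trans (LMp _ iG); apply: leq_addl.
Qed.

End Omega1.

(** * Lower l1-estimates and normalized blocks *)

Section L1Estimates.
Context {R : realType} {E : completeNormedModType R}.
Implicit Types (x y : nat -> E) (t : R) (A : set {fset nat}).

(** As in the definition of spreading models, the vector of index i >= 1 is
    [x i.-1]. *)
Definition l1_lower A x t := forall F, A F -> forall a : nat -> R,
  t * (\sum_(i <- F) `|a i|) <= `|\sum_(i <- F) a i *: x i.-1|.

(** Testing the upper estimate on a single vector of norm one gives C >= 1, and
    hence c >= C / K >= 1 / K. *)
Lemma l1_spreading_model_lower A x K : 0 < K -> normalized x ->
  l1_spreading_model A x K -> l1_lower A x K^-1.
Proof.
move=> K0 x1 xK F AF a; have [c [C [c0 C0 cCK cC]]] := xK F AF.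
have [->|[n nF]] := fset_0Vmem F; first by rewrite !big_seq_fset0 mulr0.
have C1 : 1 <= C.
  have [_] := cC (fun i => if i == n then 1 else 0).
  have -> : \sum_(i <- F) `|(if i == n then 1 else 0) : R| = 1.
    rewrite (big_fsetD1 n) //= eqxx normr1 big1_fset ?addr0 // => i.
    by rewrite !inE => /andP[/negPf-> _]; rewrite normr0.
  rewrite (big_fsetD1 n) //= eqxx scale1r big1_fset ?addr0; last first.
    by move=> i; rewrite !inE => /andP[/negPf-> _]; rewrite scale0r.
  by rewrite x1 mulr1.
have [+ _] := cC a; apply: le_trans; apply: ler_wpM2r.
  by apply: sumr_ge0 => i _; exact: normr_ge0.
rewrite -div1r ler_pdivrMr //; apply: le_trans C1 _.
by rewrite -ler_pdivrMl.
Qed.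

Lemma l1_lower_spreading_model A x t : 0 < t -> normalized x ->
  l1_lower A x t -> l1_spreading_model A x t^-1.
Proof.
move=> t0 x1 xt F AF; exists t, 1; split=> //; first by rewrite mulr1.
move=> a; split; first exact: xt.
rewrite mul1r; apply: le_trans (ler_norm_sum _ _ _) _.
by apply: ler_sum => i _; rewrite normrZ x1 mulr1.
Qed.

Definition block_comb x m n : set E :=
  [set z | exists a : nat -> R, z = \sum_(m <= i < n) a i *: x i].

Lemma block_comb_cat x m k n u v : (m <= k <= n)%N ->
  block_comb x m k u -> block_comb x k n v -> block_comb x m n (u + v).
Proof.
move=> /andP[mk kn] [a ->] [b ->].
exists (fun i => if (i < k)%N then a i else b i).
rewrite (big_cat_nat mk kn) /=; congr (_ + _); apply: eq_big_nat => i /andP[].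
  by move=> _ ->.
by rewrite leqNgt => /negPf->.
Qed.

Lemma block_comb_scale x m n (c : R) u :
  block_comb x m n u -> block_comb x m n (c *: u).
Proof.
move=> [a ->]; exists (fun i => c * a i).
by rewrite scaler_sumr; apply: eq_bigr => i _; rewrite scalerA.
Qed.

Lemma block_comb_fset x m n (F : {fset nat}) (a : nat -> R) :
  (forall i, i \in F -> (m < i <= n)%N) ->
  block_comb x m n (\sum_(i <- F) a i *: x i.-1).
Proof.
move=> Fmn; exists (fun i => if i.+1 \in F then a i.+1 else 0).
rewrite (perm_big [seq i <- index_iota m.+1 n.+1 | i \in F]).
  rewrite big_filter big_mkcond big_add1; apply: eq_bigr => i _ /=.
  by case: ifP => // _; rewrite scale0r.
apply: uniq_perm => [||i]; rewrite ?fset_uniq ?filter_uniq ?iota_uniq //.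
rewrite mem_filter mem_index_iota ltnS.
by have [/Fmn->|] := boolP (i \in F).
Qed.

(** Block bases with coefficients chosen separately in each block, which
    compose more readily than those of one coefficient sequence. *)
Definition normalized_blocks x y := normalized y /\
  exists p : nat -> nat, {homo p : m n / (m < n)%N} /\
    forall n, block_comb x (p n) (p n.+1) (y n).

Lemma normalized_blocks_shift x m : normalized x ->
  normalized_blocks x (fun n => x (n + m)%N).
Proof.
move=> x1; split=> [n|]; first exact: x1.
exists (addn^~ m); split=> [i j|n]; first by rewrite ltn_add2r.
by exists (fun=> 1); rewrite addSn big_nat1 scale1r.
Qed.

Lemma normalized_blocks_trans x y z :
  normalized_blocks x y -> normalized_blocks y z -> normalized_blocks x z.
Proof.
move=> [_ [p [ph py]]] [z1 [q [qh qz]]]; split=> //; exists (p \o q).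
split=> [m n mn|n]; first exact/ph/qh.
have [b ->] := qz n; have ple := homo_ltn_leq ph.
have := ltnW (qh _ _ (ltnSn n)); rewrite /=; move: (q n) (q n.+1) => m k.
elim: k => [|k IH].
  by rewrite leqn0 => /eqP->; exists (fun=> 0); rewrite !big_geq.
rewrite leq_eqVlt => /orP[/eqP->|]; first by exists (fun=> 0); rewrite !big_geq.
rewrite ltnS => mk; rewrite big_nat_recr //=.
apply: (block_comb_cat (k := p k)); last exact: block_comb_scale.
  by rewrite !ple.
exact: IH.
Qed.

Lemma normalized_blocks_block_basis x y :
  normalized_blocks x y -> block_basis x y.
Proof.
move=> [y1 [p [ph /choice[A py]]]]; have [a aA] := glue_blocks A ph.
exists p, a; split=> // n; split; last by rewrite -normr_gt0 y1.
by rewrite py; apply: eq_big_nat => i /aA->.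
Qed.

(** The block sequence is obtained by normalizing vectors [v i] that witness the
    failure of the estimate with constant [t] further and further out: relative
    to the norm of [v i], its coefficients have absolute sum more than 1 / t, and
    this gains one factor t over the constant t ^+ 2. *)
Lemma james_blocks (A B : set {fset nat}) (L : nat -> nat)
    (x : nat -> E) (t : R) :
  (forall i, (0 < i)%N -> A [fset i]%fset) ->
  (forall F, A F -> forall i, i \in F -> (0 < i)%N) ->
  sparse_comp_sub L A A B ->
  0 < t -> l1_lower B x (t ^+ 2) ->
  (forall N,
    ~ l1_lower (A `&` [set F | forall i, i \in F -> (N <= i)%N]) x t) ->
  exists2 y, normalized_blocks x y & l1_lower A y t.
Proof.
move=> A1 A_gt0 AAB t0 xB xA.
have /choice[F0 /choice[c0 Fc]] N : exists F (c : nat -> R),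
    [/\ A F, forall i, i \in F -> (N <= i)%N &
     `|\sum_(i <- F) c i *: x i.-1| < t * \sum_(i <- F) `|c i|].
  have /existsNP[F /not_implyP[[AF NF] /existsNP[c /negP]]] := xA N.
  by rewrite -ltNge => ct; exists F, c.
have [|p [ph p0 Lp Fp]] := sparse_blocks (F := F0) L; first by move=> N; case: (Fc N).
pose F i := F0 (p i); pose c i := c0 (p i).
pose v i := \sum_(j <- F i) c i j *: x j.-1.
have FA i : A (F i) by case: (Fc (p i)).
have vlt i : `|v i| < t * \sum_(j <- F i) `|c i j| by case: (Fc (p i)).
have cover G : A G -> B (\bigcup_(i <- G) F i)%fset.
  by move=> GA; apply: (AAB p) => // i _; split=> //; exact: Fp.
have v0 i : (0 < i)%N -> 0 < `|v i|.
  move=> i0; apply: lt_le_trans (_ : t ^+ 2 * \sum_(j <- F i) `|c i j| <= _).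
    rewrite mulr_gt0 ?exprn_gt0 // -(pmulr_rgt0 _ t0).
    exact: le_lt_trans (vlt i).
  (* The singleton of i is in A, so that F i alone is already in B. *)
  apply: xB; rewrite -[F i](big_seq_fset1 fsetU); apply: cover.
  exact: A1.
pose y n := `|v n.+1|^-1 *: v n.+1.
exists y.
  split=> [n|]; first by rewrite normrZ normfV normr_id mulVf // gt_eqF ?v0.
  (* y n has index n + 1, which explains the block p n.+1; the predecessor is
     the shift between the indices of the vectors and their storage in x. *)
  exists (fun n => (p n.+1).-1); split=> [m n mn|n].
    by rewrite -ltnS !prednK // ph.
  apply/block_comb_scale/block_comb_fset => j /Fp.
  by rewrite prednK // -[in (j <= _)%N]ltnS prednK.
move=> G GA b.
have yE i : i \in G -> y i.-1 = `|v i|^-1 *: v i.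
  by move=> /(A_gt0 _ GA) i0; rewrite /y prednK.
have [e eE] := glue_blocks (fun i j => b i / `|v i| * c i j) ph.
have disjF i j : i \in G -> j \in G -> i != j -> [disjoint F i & F j]%fset.
  move=> _ _; rewrite neq_ltn.
  have lt k l : (k < l)%N -> [disjoint F k & F l]%fset.
    move=> kl; apply/fdisjointP => n /Fp/andP[_ nk]; apply/negP => /Fp/andP[ln _].
    by have := leq_trans nk (leq_trans (homo_ltn_leq ph kl) ln); rewrite ltnn.
  by move=> /orP[/lt//|/lt]; rewrite fdisjoint_sym.
have -> : \sum_(i <- G) b i *: y i.-1 =
          \sum_(j <- (\bigcup_(i <- G) F i)%fset) e j *: x j.-1.
  rewrite partition_disjoint_bigfcup //; apply: eq_big_seq => i iG.
  rewrite yE // scalerA scaler_sumr; apply: eq_big_seq => j jF.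
  by rewrite scalerA (eE i) // Fp.
apply: le_trans (xB _ (cover _ GA) e).
rewrite partition_disjoint_bigfcup // expr2 -mulrA ler_pM2l // mulr_sumr.
rewrite big_seq [leRHS]big_seq; apply: ler_sum => i iG.
have i0 := v0 _ (A_gt0 _ GA _ iG).
under eq_big_seq => j jF do rewrite (eE i) ?Fp // normrM normrM normfV normr_id.
rewrite -mulr_sumr mulrCA -mulrA ler_peMr // mulrC ler_pdivlMr // mul1r.
exact: ltW.
Qed.

End L1Estimates.

(** * Improving the constant *)

Section James.
Context {d : Order.disp_t} {W : orderType d}.
Hypothesis W_omega1 : is_omega1 W.
Context {lam : W -> nat -> W} (lam_fund : fundamental_system lam).
Context {R : realType}.

Lemma l1_lower_shift a (E : completeNormedModType R) (x : nat -> E) (t : R) N :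
  l1_lower (schreier lam a `&` [set F | forall i, i \in F -> (N <= i)%N]) x t ->
  l1_lower (schreier lam a) (fun n => x (n + N)%N) t.
Proof.
move=> xt F Fa c; have F0 := schreier_gt0 W_omega1 Fa.
pose G := (\bigcup_(i <- F) [fset (i + N)%N])%fset.
have sum_shift (V : nmodType) (f : nat -> V) :
    \sum_(i <- G) f i = \sum_(i <- F) f (i + N)%N.
  by rewrite /G bigfcup_imfset1 big_imfset //= => i j _ _; exact: addIn.
have -> : \sum_(i <- F) `|c i| = \sum_(j <- G) `|c (j - N)%N|.
  by rewrite sum_shift; apply: eq_bigr => i _; rewrite addnK.
have -> : \sum_(i <- F) c i *: x (i.-1 + N)%N =
          \sum_(j <- G) c (j - N)%N *: x j.-1.
  rewrite sum_shift; apply: eq_big_seq => i /F0.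
  by case: i => // i _; rewrite addnK addSn.
apply: (xt G _ (fun j => c (j - N)%N)); split.
  by apply: schreier_spread => // i j; rewrite ltn_add2r.
by move=> i /bigfcupP[j _]; rewrite inE => /eqP->; exact: leq_addl.
Qed.

(** James' dichotomy: if no tail of [x] satisfies the estimate, then
    [james_blocks] applies. *)
Lemma james_step (a : W) : exists b : W,
  forall (E : completeNormedModType R) (x : nat -> E) (t : R), 0 < t ->
  normalized x -> l1_lower (schreier lam b) x (t ^+ 2) ->
  exists2 y, normalized_blocks x y & l1_lower (schreier lam a) y t.
Proof.
have [b [L abL]] := schreier_comp W_omega1 lam_fund a a.
exists b => E x t t0 x1 xb.
have [[N xN]|/forallNP] := pselect (exists N, l1_lower
    (schreier lam a `&` [set F | forall i, i \in F -> (N <= i)%N]) x t).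
  exists (fun n => x (n + N)%N); first exact: normalized_blocks_shift.
  exact: l1_lower_shift.
apply: james_blocks abL t0 xb => [i i0|]; last exact: schreier_gt0.
by apply: schreier0_sub => //; right; exists i.
Qed.

Lemma james_iter (k : nat) (a : W) : exists b : W,
  forall (E : completeNormedModType R) (x : nat -> E) (t : R), 0 < t ->
  normalized x -> l1_lower (schreier lam b) x (t ^+ (2 ^ k)) ->
  exists2 y, normalized_blocks x y & l1_lower (schreier lam a) y t.
Proof.
elim: k a => [|k IH] a.
  exists a => E x t _ x1 xt; exists (fun n => x (n + 0)%N).
    exact: normalized_blocks_shift.
  by rewrite (_ : (fun n => _) = x) //; apply/funext => n; rewrite addn0.
have [b bP] := james_step a; have [b' bP'] := IH b.
exists b' => E x t t0 x1 xt.
have [||y xy yt] := bP' E x (t ^+ 2) _ x1; first exact: exprn_gt0.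
  by rewrite -exprM -expnS.
have [z yz zt] := bP E y t t0 xy.1 yt; exists z => //.
exact: normalized_blocks_trans xy yz.
Qed.

End James.

Lemma exists_expr_pow2_ge (R : archiRealFieldType) (e K : R) : 0 < e ->
  exists k, K <= (1 + e) ^+ (2 ^ k).
Proof.
move=> e0.
have bernoulli n : n%:R * e <= (1 + e) ^+ n.
  elim: n => [|n IH]; first by rewrite mul0r expr0.
  rewrite exprS mulrDl mul1r -natr1 mulrDl mul1r lerD // ler_peMr ?(ltW e0) //.
  by rewrite exprn_ege1 // lerDl ltW.
exists (Num.bound (K / e)); apply: le_trans (bernoulli _).
rewrite -ler_pdivrMr //; apply: le_trans (ltW (unstable.ltr_bound _)) _.
by rewrite ler_nat ltnW // ltn_expl.
Qed.

Theorem theorem6p4 (R : realType) (d : Order.disp_t) (W : orderType d)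
    (W_omega1 : is_omega1 W)
    (lam : W -> nat -> W) (lam_fund : fundamental_system lam)
    (K : R) (K_gt1 : 1 < K) (eps : R) (eps_gt0 : 0 < eps) (alpha : W) :
  exists beta : W,
    forall (E : completeNormedModType R) (x : nat -> E),
      normalized x -> basic_sequence x ->
      l1_spreading_model (schreier lam beta) x K ->
      exists y : nat -> E,
        [/\ normalized y, block_basis x y
          & l1_spreading_model (schreier lam alpha) y (1 + eps)].
Proof.
have K0 : 0 < K := lt_trans ltr01 K_gt1.
have e0 : 0 < 1 + eps by rewrite addr_gt0.
have [k kK] := exists_expr_pow2_ge K eps_gt0.
have [beta betaP] := james_iter W_omega1 lam_fund (R := R) k alpha.
exists beta => E x x1 _ xK.
have [||y xy yt] := betaP E x (1 + eps)^-1 _ x1; first by rewrite invr_gt0.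
  move=> F Fb a.
  apply: le_trans (l1_spreading_model_lower K0 x1 xK Fb a).
  apply: ler_wpM2r; first by apply: sumr_ge0 => i _; exact: normr_ge0.
  by rewrite exprVn lef_pV2 // posrE exprn_gt0.
exists y; split; [exact: xy.1|exact: normalized_blocks_block_basis|].
rewrite -[1 + eps]invrK; apply: l1_lower_spreading_model => //.
  by rewrite invr_gt0.
exact: xy.1.
Qed.
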